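(* Let $G$ be a countably infinite group. Then all (symbolic) Bernoulli shifts over $G$ Borel factor onto one another.
   Context: For a compact metrizable space $K$, the (symbolic) Bernoulli shift $K^G$ over $G$ is the set of functions $x : G \to K$, endowed with the topology of pointwise convergence, together with the left coordinate-permutation action of $G$: $(g\cdot x)(h) = x(g^{-1}h)$ for $g,h \in G$ and $x \in K^G$. All actions of $G$ are assumed to be Borel actions on standard Borel spaces. Given two actions $G \curvearrowright Y$ and $G \curvearrowright X$, one says that $G \curvearrowright Y$ Borel factors onto $G \curvearrowright X$ if there is a $G$-equivariant Borel surjection $\phi : Y \to X$.
   Formalization: The Bernoulli shift K^G is assumed to have an alphabet K with at least two points, and the target alphabet L is assumed nonempty; without this the claim fails, since a one-point shift cannot factor onto a larger one. *)

(* Defs.v *)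
From HB Require Import structures.
From mathcomp Require Import all_boot all_order all_algebra.
From mathcomp Require Import all_classical all_reals all_analysis.

Set Implicit Arguments.
Unset Strict Implicit.
Unset Printing Implicit Defensive.

Import Order.TTheory GRing.Theory Num.Theory.

Local Open Scope classical_set_scope.
Local Open Scope ring_scope.

Definition metrizable (R : realType) (K : topologicalType) : Prop :=
  exists d : K -> K -> R,
    [/\ forall x y, d x y = 0 <-> x = y,
        forall x y, d x y = d y x,
        forall x y z, d x z <= d x y + d y z
      & forall x, nbhs x = nbhs_ball_ (fun y e => [set z | d y z < e]) x].

(* K^G as a measurable space: functions G -> K with the Borel sigma-algebra of
   the topology of pointwise convergence. *)
Definition bernoulli (G : groupType) (K : ptopologicalType) : Type :=
  g_sigma_algebraType (@open {ptws G -> K}).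

HB.instance Definition _ (G : groupType) (K : ptopologicalType) :=
  Measurable.copy (bernoulli G K) (g_sigma_algebraType (@open {ptws G -> K})).

Definition bernoulli_shift (G : groupType) (K : ptopologicalType)
    (g : G) (x : bernoulli G K) : bernoulli G K :=
  fun h => x (g^-1 * h)%g.

Lemma bernoulli_shift1 (G : groupType) (K : ptopologicalType) (x : bernoulli G K) :
  bernoulli_shift 1%g x = x.
Proof. by apply/funext => h; rewrite /bernoulli_shift invg1 mul1g. Qed.

Lemma bernoulli_shiftM (G : groupType) (K : ptopologicalType) (g h : G)
  (x : bernoulli G K) : bernoulli_shift (g * h)%g x = bernoulli_shift g (bernoulli_shift h x).
Proof. by apply/funext => k; rewrite /bernoulli_shift invgM mulgA. Qed.

Definition borel_factors_onto (G : Type) (dY dX : measure_display)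
    (Y : measurableType dY) (X : measurableType dX)
    (actY : G -> Y -> Y) (actX : G -> X -> X) : Prop :=
  exists phi : Y -> X,
    [/\ measurable_fun [set: Y] phi,
        forall g y, phi (actY g y) = actX g (phi y)
      & set_surj [set: Y] [set: X] phi].

(* Main.v *)
Require Import Defs.
From HB Require Import structures.
From mathcomp Require Import all_boot all_order all_algebra.
From mathcomp Require Import all_classical all_reals all_analysis.

Import Order.TTheory GRing.Theory Num.Theory.

Local Open Scope classical_set_scope.

(** Call a Borel set [T] in [K^G] wandering when its translates [g T] are
pairwise disjoint.  On the union [G T] of these translates the action is free
with [T] as a Borel transversal, so an arbitrary Borel map [psi] from [T] to
[L^G] extends in exactly one way to an equivariant map on [G T]; off [G T] the
map may be constant, equal to a fixed point of the shift on [L^G].  The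
extension is onto as soon as [psi] is ([borel_factor_of_wandering_set]).  No
entropy inequality stands in the way, even for amenable [G], because [G T] is a
disjoint union of infinitely many translates of [T] and so carries no invariant
probability measure.

It remains to find a wandering Borel set that surjects onto [L^G], a compact
metrizable space and hence a continuous image of the Cantor space
([metrizable_cantor_image], [cantor_onto_ptws]).  So a copy of the Cantor space
suffices.  Choose a sequence [p] of distinct elements of [G] so sparse that
[g p] meets [p] in a finite set for each [g] other than the identity
([exists_thin_sequence]), and two points [a], [b] of [K].  A binary sequence
[s] is coded by the configuration equal to [b] at exactly one of [p (2 n)] and
[p (2 n + 1)] for each [n], the choice being [s n], and equal to [a] elsewhere.
The set where a coded configuration is [b] is an infinite subset of [p];
translating it by a nontrivial [g] cannot give another subset of [p], so the
coded configurations form a wandering set ([range_code_wandering]).  It is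
compact, hence Borel, because coding is continuous, and decoding is continuous
on it ([decode_continuous]). *)

(** * Equivariant extension from a wandering set *)

(** [psi] prescribes the factor map on a transversal of [G T]; equivariance then
forces its value at [y] to be [g^-1 psi (g y)] for the only [g] with [g y] in
[T].  Countability of [G] makes this a countable Borel gluing. *)
Lemma borel_factor_of_wandering_set (G : groupType) (dY dX : measure_display)
    (Y : measurableType dY) (X : measurableType dX)
    (actY : G -> Y -> Y) (actX : G -> X -> X)
    (T : set Y) (psi : Y -> X) (x0 : X) :
  countable [set: G] ->
  (forall y, actY 1%g y = y) ->
  (forall g h y, actY (g * h)%g y = actY g (actY h y)) ->
  (forall g, measurable_fun [set: Y] (actY g)) ->
  (forall x, actX 1%g x = x) ->
  (forall g h x, actX (g * h)%g x = actX g (actX h x)) ->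
  (forall g, measurable_fun [set: X] (actX g)) ->
  (forall g, actX g x0 = x0) ->
  measurable T ->
  (forall g y, T y -> T (actY g y) -> g = 1%g) ->
  measurable_fun T psi ->
  set_surj T [set: X] psi ->
  borel_factors_onto actY actX.
Proof.
move=> cG actY1 actYM mY actX1 actXM mX fix0 mT wT mpsi spsi.
pose phi y := if pselect (exists g, T (actY g y)) is left e
  then actX (projT1 (cid e))^-1%g (psi (actY (projT1 (cid e)) y)) else x0.
(* Two return times [g], [h] of [y] to [T] differ by an element carrying a point
   of [T] into [T], so [phi] does not depend on the one that was picked. *)
have phiE g y : T (actY g y) -> phi y = actX g^-1%g (psi (actY g y)).
  rewrite /phi => Tgy; case: pselect => [e|]; last by case; exists g.
  case: (cid e) => /= h Thy; suff -> : h = g by [].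
  have: T (actY (g * h^-1)%g (actY h y)) by rewrite -actYM mulgVK.
  by move/(wT _ _ Thy)/eqP; rewrite divg_eq1 => /eqP.
have phi0 y : ~ (exists g, T (actY g y)) -> phi y = x0.
  by rewrite /phi; case: pselect.
exists phi; split.
- move=> _ B mB; rewrite setTI.
  pose E := \bigcup_g (actY g @^-1` T).
  have -> : phi @^-1` B =
      \bigcup_g (actY g @^-1` (T `&` psi @^-1` (actX g^-1%g @^-1` B)))
      `|` (~` E `&` cst x0 @^-1` B).
    apply/seteqP; split => y /=.
      have [[g Tgy]|nT] := pselect (exists g, T (actY g y)).
        by rewrite (phiE _ _ Tgy) => By; left; exists g.
      rewrite (phi0 _ nT) => Bx; right; split => //.
      by move=> [g _ Tgy]; apply: nT; exists g.
    move=> [[g _ [Tgy By]]|[nT Bx]]; first by rewrite (phiE _ _ Tgy).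
    by rewrite phi0// => -[g Tgy]; apply: nT; exists g.
  have mact g (A : set Y) : measurable A -> measurable (actY g @^-1` A).
    by move=> mA; rewrite -[X in measurable X]setTI; exact: mY.
  apply: measurableU.
    apply: countable_bigcupT_measurable => // g; apply: mact.
    by apply: mpsi => //; rewrite -[X in measurable X]setTI; exact: mX.
  apply: measurableI.
    apply: measurableC; apply: countable_bigcupT_measurable => // g.
    exact: mact.
  by rewrite -[X in measurable X]setTI; exact: measurable_cst.
- move=> h y; have [[g Tgy]|nT] := pselect (exists g, T (actY g y)).
    have Tghy : T (actY (g * h^-1)%g (actY h y)) by rewrite -actYM mulgVK.
    by rewrite (phiE _ _ Tghy) (phiE _ _ Tgy) -actYM mulgVK invgM invgK actXM.
  rewrite (phi0 _ nT) phi0 ?fix0// => -[g Tghy].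
  by apply: nT; exists (g * h)%g; rewrite actYM.
- move=> x _; have [y Ty <-] := spsi x I; exists y => //.
  by rewrite (phiE 1%g) actY1// invg1 actX1.
Qed.

(** * A sparse sequence in a countably infinite group *)

(** Dependent choice in which each term may depend on all the previous ones. *)
Lemma exists_seq_from_history (T : Type) (Q : seq T -> T -> Prop) :
  (forall s, exists y, Q s y) ->
  exists p : nat -> T, forall n, Q (mkseq p n) (p n).
Proof.
move=> /choice[next nextP].
pose hist := fix hist n :=
  if n is m.+1 then rcons (hist m) (next (hist m)) else [::].
exists (next \o hist) => n.
suff -> : mkseq (next \o hist) n = hist n by exact: nextP.
elim: n => // n IHn.
by rewrite /mkseq -addn1 iotaD map_cat [map _ _]IHn addn1 /= cats1.
Qed.

(** Rank [G] by an injection [r] into the naturals and choose the terms greedily: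
the [n]-th term must form, with every earlier term in either order, quotients of
rank at least [n], which excludes finitely many candidates.  A given [g] is then
a quotient of terms of index at most [r g] only, so that [g p] meets [p] in a
finite set. *)
Lemma exists_thin_sequence (G : groupType) :
  countable [set: G] -> infinite_set [set: G] ->
  exists p : nat -> G, injective p /\
    forall g, g != 1%g -> exists N, forall i j, (g * p i)%g = p j -> (i <= N)%N.
Proof.
move=> /countable_injP[r r_inj'] iG.
have r_inj : injective r by move=> x y; apply: r_inj'; rewrite inE.
pose Q s y := forall x : G, x \in s ->
  [/\ y != x, (size s <= r (y * x^-1)%g)%N & (size s <= r (x * y^-1)%g)%N].
have Q_ex s : exists y, Q s y.
  pose low := r @^-1` `I_(size s).
  have flow : finite_set low.
    by apply: finite_preimage; [move=> ? ? _ _; exact: r_inj|exact: finite_II].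
  pose bad := [set` s] `|` (fun kx => kx.1 * kx.2)%g @` (low `*` [set` s])
    `|` (fun kx => kx.1^-1 * kx.2)%g @` (low `*` [set` s]).
  have fbad : finite_set bad.
    rewrite /bad !finite_setU; split; [split|].
    - exact: finite_seq.
    - by apply/finite_image/finite_setX => //; exact: finite_seq.
    - by apply/finite_image/finite_setX => //; exact: finite_seq.
  have [y [_ ybad]] := infinite_setN0 (infinite_setD iG fbad).
  exists y => x xs; split.
  - by apply/eqP => yx; apply: ybad; left; left; rewrite yx.
  - rewrite leqNgt; apply/negP => lt; apply: ybad; left; right.
    by exists ((y * x^-1)%g, x); rewrite //= mulgVK.
  - rewrite leqNgt; apply/negP => lt; apply: ybad; right.
    by exists ((x * y^-1)%g, x); rewrite //= invgM invgK mulgVK.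
have [p pP] := exists_seq_from_history _ _ Q_ex.
have {}pP i n : (i < n)%N -> [/\ p n != p i,
    (n <= r (p n * (p i)^-1)%g)%N & (n <= r (p i * (p n)^-1)%g)%N].
  move=> ltin; have := pP n (p i); rewrite size_mkseq; apply.
  by apply/mapP; exists i; rewrite // mem_iota.
exists p; split.
  move=> i j pij; case: (ltngtP i j) => // lt.
    by have [] := pP _ _ lt; rewrite pij eqxx.
  by have [] := pP _ _ lt; rewrite pij eqxx.
move=> g g1; exists (r g) => i j gij.
have -> : g = (p j * (p i)^-1)%g by rewrite -gij mulgK.
have [ji|ij|ij] := ltngtP j i; first by have [] := pP _ _ ji.
  by have [_ + _] := pP _ _ ij; apply: leq_trans; exact: ltnW.
by move: g1; rewrite -(mulgK (p i) g) gij ij mulgV eqxx.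
Qed.

(** * Compact metrizable spaces *)

Section metrizable.
Local Open Scope ring_scope.

Lemma metrizable_dist_ge0 (R : realType) (K : Type) (d : K -> K -> R) :
  (forall x, d x x = 0) -> (forall x y, d x y = d y x) ->
  (forall x y z, d x z <= d x y + d y z) -> forall x y, 0 <= d x y.
Proof.
move=> d0 dC dT x y; have := dT x y x.
by rewrite d0 (dC y) -mulr2n pmulrn_lge0.
Qed.

Lemma metrizable_hausdorff (R : realType) (K : topologicalType) :
  metrizable R K -> hausdorff_space K.
Proof.
move=> [d [d0 dC dT dnbhs]] x y xy; apply/d0.
have dxx z : d z z = 0 by apply/d0.
apply/eqP; rewrite eq_le (metrizable_dist_ge0 _ _ d)// andbT leNgt.
apply/negP => dpos; have e0 : 0 < d x y / 2 by rewrite divr_gt0.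
have nb z : nbhs z [set w | d z w < d x y / 2].
  by rewrite dnbhs; exists (d x y / 2).
have [z [/= xz yz]] := xy _ _ (nb x) (nb y).
have := dT x z y; rewrite leNgt => /negP; apply.
by rewrite [ltRHS]splitr ltrD// dC.
Qed.

(** The Alexandroff-Hausdorff theorem for a space whose metric is only known to
exist.  The uniformity and the balls defined from the metric are added on top
of the given topology, so that continuity keeps its meaning. *)
Lemma metrizable_cantor_image (R : realType) (L : ptopologicalType) :
  compact [set: L] -> metrizable R L ->
  exists f : cantor_space -> L,
    continuous f /\ set_surj [set: cantor_space] [set: L] f.
Proof.
move=> cL mL; have hL := metrizable_hausdorff _ _ mL.
have [d [d0 dC dT dnbhs]] := mL.
have dxx z : d z z = 0 by apply/d0.
pose dball (x : L) (e : R) := [set y | d x y < e].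
have bcenter x e : 0 < e -> dball x e x by rewrite /dball /= dxx.
have bsym x y e : dball x e y -> dball y e x by rewrite /dball /= dC.
have btri x y z e1 e2 : dball x e1 y -> dball y e2 z -> dball x (e1 + e2) z.
  by rewrite /dball /= => xy yz; apply: le_lt_trans (dT x y z) _; exact: ltrD.
have bnbhs : nbhs = nbhs_ (entourage_ dball).
  apply/funext => x; rewrite dnbhs; apply/seteqP; split => A.
    move=> [e e0 sA]; exists [set xy | dball xy.1 e xy.2]; first by exists e.
    by move=> y /xsectionP; exact: sA.
  move=> [E [e e0 sE] sA]; exists e => // y ye; apply: sA.
  by apply/xsectionP; exact: sE.
have entF : Filter (entourage_ dball).
  apply: filter_from_filter; first by exists 1 => /=.
  move=> e1 e2 /= e10 e20; exists (Num.min e1 e2); first by rewrite /= lt_min e10.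
  by move=> [x y]; rewrite /dball /= lt_min => /andP[].
have entD A : entourage_ dball A -> diagonal `<=` A.
  by move=> [e e0 sA] [x y]; rewrite /diagonal /= => ->; apply: sA; exact: bcenter.
have entI A : entourage_ dball A -> entourage_ dball A^-1%relation.
  by move=> [e e0 sA]; exists e => // -[x y] xy; apply: sA; exact: bsym.
have entS A : entourage_ dball A ->
    exists2 B, entourage_ dball B & (B \; B)%relation `<=` A.
  move=> [e e0 sA]; exists [set xy | dball xy.1 (e / 2) xy.2].
    by exists (e / 2) => //=; rewrite divr_gt0.
  move=> [x y] [z xz zy]; apply: sA => /=.
  by rewrite [e]splitr; exact: btri zy.
pose U : uniformType := HB.pack_for uniformType (Topological.sort L)
  (Nbhs_isUniform_mixin.Build L entF entD entI entS bnbhs).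
have entE : @entourage U = entourage_ dball by [].
pose M : pseudoPMetricType R := HB.pack_for (pseudoPMetricType R) (Uniform.sort U)
  (Uniform_isPseudoMetric.Build R U bcenter bsym btri entE)
  (isPointed.Build U (point : L)).
have [f cf] := @cantor_surj R M cL hL.
exists f; split; first exact: cf.
exact: (@surj _ _ _ _ f).
Qed.

End metrizable.

(** * Pointwise convergence *)

Lemma continuous_ptws (X : topologicalType) (I : Type) (V : topologicalType)
    (f : X -> {ptws I -> V}) :
  (forall i, continuous (fun x => f x i)) -> continuous f.
Proof.
move=> cf x; apply/cvg_sup => i.
exact: (@continuous_comp_initial {ptws I -> V} X V (fun g => g i) f (cf i)).
Qed.

Lemma continuous_ptws_eval (I : Type) (V : topologicalType) (i : I) :
  continuous (fun f : {ptws I -> V} => f i).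
Proof.
move=> f; have /cvg_sup/(_ i) cvi : f --> f by apply: cvg_id.
apply: cvg_trans (@initial_continuous {ptws I -> V} V (fun g => g i) f).
by apply: cvg_app.
Qed.

Lemma hausdorff_ptws (I : Type) (V : topologicalType) :
  hausdorff_space V -> hausdorff_space {ptws I -> V}.
Proof.
move=> hV f g fg; apply/funext => i; apply: hV => A B fA gB.
have [h [Ah Bh]] := fg _ _ (continuous_ptws_eval _ _ i f _ fA)
                           (continuous_ptws_eval _ _ i g _ gB).
by exists (h i).
Qed.

(** A binary sequence splits into one binary sequence for each index, and each
of these is sent to [L] by [f]. *)
Lemma cantor_onto_ptws (J : Type) (L : topologicalType) (f : cantor_space -> L) :
  countable [set: J] -> continuous f ->
  set_surj [set: cantor_space] [set: L] f ->
  exists F : cantor_space -> {ptws J -> L},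
    continuous F /\ set_surj [set: cantor_space] [set: {ptws J -> L}] F.
Proof.
move=> /countable_injP[r r_inj] cf sf.
pose digit (i : J) (n : nat) := pickle (r i, n).
have digit_inj i n i' n' : digit i n = digit i' n' -> (i, n) = (i', n').
  by move=> /(pcan_inj pickleK)[/r_inj ri ->]; rewrite ri ?inE.
exists (fun s i => f (fun n => s (digit i n))); split.
  apply: continuous_ptws => i.
  have c_digit : continuous ((fun s n => s (digit i n)) : cantor_space -> cantor_space).
    apply: (@continuous_ptws cantor_space nat bool) => n.
    exact: (continuous_ptws_eval nat bool (digit i n)).
  by move=> s; exact: (continuous_comp (c_digit s) (cf _)).
move=> y _; have /choice[t tP] : forall i, exists t, f t = y i.
  by move=> i; have [t _ <-] := sf (y i) I; exists t.
have /choice[s sP] : forall m, exists c, forall i n, digit i n = m -> t i n = c.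
  move=> m; have [[[i n] <-]|nm] := pselect (exists q, digit q.1 q.2 = m).
    by exists (t i n) => i' n' /digit_inj[-> ->].
  by exists false => i n im; case: nm; exists (i, n).
exists s => //; apply/funext => i; rewrite -tP; congr f.
by apply/funext => n; rewrite -(sP _ i n erefl).
Qed.

(** * Borel structure of Bernoulli shifts *)

Section bernoulli_borel.
Context (G : groupType) (K : ptopologicalType).

Lemma open_bernoulli_measurable (A : set {ptws G -> K}) :
  open A -> measurable (A : set (bernoulli G K)).
Proof. by move=> oA; exact: sub_sigma_algebra. Qed.

Lemma closed_bernoulli_measurable (A : set {ptws G -> K}) :
  closed A -> measurable (A : set (bernoulli G K)).
Proof.
move=> cA; rewrite -(setCK A); apply: measurableC.
by apply: open_bernoulli_measurable; exact: closed_openC.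
Qed.

End bernoulli_borel.

(** Continuity is relative to [T] because decoding tests whether a symbol equals
[a], which in general depends continuously on the configuration only among the
coded ones. *)
Lemma continuous_bernoulli_measurable (G : groupType) (K L : ptopologicalType)
    (T : set {ptws G -> K}) (f : {ptws G -> K} -> {ptws G -> L}) :
  measurable (T : set (bernoulli G K)) -> {within T, continuous f} ->
  measurable_fun (T : set (bernoulli G K)) (f : bernoulli G K -> bernoulli G L).
Proof.
move=> mT /continuousP cf.
apply: (@measurability _ _ (bernoulli G K) (bernoulli G L) T f
  (@open {ptws G -> L})) => //.
move=> _ [B oB <-].
have /open_subspaceP[V oV VT] := cf _ oB.
rewrite setIC -VT; apply: measurableI => //; exact: open_bernoulli_measurable.
Qed.

Lemma measurable_bernoulli_shift (G : groupType) (K : ptopologicalType) (g : G) :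
  measurable_fun [set: bernoulli G K] (bernoulli_shift g).
Proof.
apply: (@continuous_bernoulli_measurable G K K setT) => //.
apply: continuous_subspaceT; apply: continuous_ptws => h.
exact: (continuous_ptws_eval G K (g^-1 * h)%g).
Qed.

(** * A wandering copy of the Cantor space *)

Section cantor_code.
Context {G : groupType} {K : ptopologicalType} (p : nat -> G) (a b : K)
  (p_inj : injective p) (ab : a <> b) (hK : hausdorff_space K)
  (p_thin : forall g, g != 1%g ->
    exists N, forall i j, (g * p i)%g = p j -> (i <= N)%N).

(** Marking one of two positions for each digit, rather than marking a position
for the digit [true] only, gives every coded configuration infinitely many
marks. *)
Definition code (s : cantor_space) : {ptws G -> K} :=
  fun h => if `[< exists n, h = p (n.*2 + s n)%N >] then b else a.

Definition decode (x : {ptws G -> K}) : cantor_space :=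
  fun n => `[< x (p n.*2.+1) <> a >].

Lemma code_on s i : code s (p i) = if s i./2 == odd i then b else a.
Proof.
rewrite /code; congr (if _ then _ else _); apply/asboolP/eqP.
  move=> [n /p_inj ->]; rewrite addnC half_bit_double oddD odd_double addbF.
  by case: (s n).
by move=> si; exists i./2; rewrite si addnC odd_double_half.
Qed.

Lemma code_off s h : (forall i, h <> p i) -> code s h = a.
Proof. by move=> hp; rewrite /code asboolF// => -[n /hp]. Qed.

Lemma codeK : cancel code decode.
Proof.
move=> s; apply/funext => n.
rewrite /decode code_on (half_bit_double n true) oddS odd_double.
case: (s n) => /=; last by rewrite asboolF.
by apply/asboolP => /esym.
Qed.

Lemma code_continuous : continuous code.
Proof.
apply: continuous_ptws => h; have [[i ->]|hp] := pselect (exists i, h = p i).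
  pose symbol (c : bool) : K := if c == odd i then b else a.
  have symbol_cts : continuous symbol.
    by apply/continuousP => A _; exact: discrete_open.
  rewrite [X in continuous X](_ : _ = symbol \o (fun s => s i./2)).
    by move=> s; exact: (continuous_comp (continuous_ptws_eval nat bool _ s)
                                         (symbol_cts _)).
  by apply/funext => s; rewrite /= code_on.
rewrite [X in continuous X](_ : _ = cst a); first exact: cst_continuous.
by apply/funext => s; rewrite code_off// => i hi; apply: hp; exists i.
Qed.

Lemma closed_range_code : closed (range code).
Proof.
apply: compact_closed; first exact: hausdorff_ptws.
apply: continuous_compact; last exact: cantor_space_compact.
by apply: continuous_subspaceT => s; exact: code_continuous.
Qed.

(** If [x] and [g x] are both coded configurations, every mark of [x] is moved
by [g] into the sequence [p], whereas thinness allows this for finitely many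
marks only. *)
Lemma range_code_wandering g (x : bernoulli G K) :
  range code x -> range code (bernoulli_shift g x) -> g = 1%g.
Proof.
move=> [s _ <-] [t _ tE]; apply/eqP; apply: contraT => /p_thin[N NP].
(* A mark of [x] whose index exceeds the bound [N]. *)
pose i := (N.+1.*2 + s N.+1)%N.
have xi : code s (p i) = b.
  by rewrite code_on /i addnC half_bit_double oddD odd_double addbF oddb eqxx.
have gxi : code t (g * p i)%g = b by rewrite tE /bernoulli_shift mulKg.
have [[j gj]|gp] := pselect (exists j, (g * p i)%g = p j).
  by have := NP _ _ gj; rewrite leqNgt /i -addnn -addnA ltn_addr.
by move: gxi; rewrite code_off// => j gj; apply: gp; exists j.
Qed.

(** A coded configuration takes only the values [a] and [b], so at a given
position each of the two is an open condition: it amounts to avoiding the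
other. *)
Lemma decode_continuous : {within range code, continuous decode}.
Proof.
have K1 c : closed [set c : K].
  exact/accessible_closed_set1/hausdorff_accessible.
apply: (@continuous_ptws (subspace (range code)) nat bool) => n.
apply/subspace_continuousP => x /= [s _ sx]; apply: cvg_near_cst.
have away c : x (p n.*2.+1) <> c -> \forall y \near x, y (p n.*2.+1) <> c.
  move=> xc; apply: (continuous_ptws_eval G K (p n.*2.+1) x (~` [set c])).
  by apply: open_nbhs_nbhs; split => //; apply: closed_openC; exact: K1.
have [xa|xa] := pselect (x (p n.*2.+1) = a).
  have /away : x (p n.*2.+1) <> b by rewrite xa.
  rewrite /within /=; apply: filterS => y yb [t _ ty].
  have ya : y (p n.*2.+1) = a.
    by move: yb; rewrite -ty code_on; case: ifP.
  suff : decode y n = decode x n by [].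
  by rewrite /decode xa ya.
rewrite /within /=; apply: filterS (away _ xa) => y ya _.
suff : decode y n = decode x n by [].
by rewrite /decode !asboolT.
Qed.

End cantor_code.

(** * Bernoulli shifts factor onto one another *)

Theorem corollary1p6 (R : realType) (G : groupType)
  (countable_G : countable [set: G]) (infinite_G : infinite_set [set: G])
  (K L : ptopologicalType)
  (compact_K : compact [set: K]) (metrizable_K : metrizable R K)
  (compact_L : compact [set: L]) (metrizable_L : metrizable R L)
  (nontrivial_K : exists a b : K, a <> b) :
  borel_factors_onto (@bernoulli_shift G K) (@bernoulli_shift G L).
Proof.
have [a [b ab]] := nontrivial_K.
have hK := metrizable_hausdorff _ _ metrizable_K.
have [p [p_inj p_thin]] := exists_thin_sequence _ countable_G infinite_G.
have [f [cf sf]] := metrizable_cantor_image _ _ compact_L metrizable_L.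
have [F [cF sF]] := cantor_onto_ptws _ _ _ countable_G cf sf.
have mT : measurable (range (code p a b) : set (bernoulli G K)).
  by apply: closed_bernoulli_measurable; exact: closed_range_code.
apply: (@borel_factor_of_wandering_set G _ _ (bernoulli G K) (bernoulli G L)
  (@bernoulli_shift G K) (@bernoulli_shift G L)
  (range (code p a b)) (F \o decode p a) (fun=> point)) => //.
- exact: bernoulli_shift1.
- exact: bernoulli_shiftM.
- exact: measurable_bernoulli_shift.
- exact: bernoulli_shift1.
- exact: bernoulli_shiftM.
- exact: measurable_bernoulli_shift.
- by move=> g y; exact: range_code_wandering.
- apply: continuous_bernoulli_measurable => // x.
  have cd := decode_continuous p a b p_inj ab hK x.
  exact: (continuous_comp cd (cF _)).
- move=> y _; have [s _ <-] := sF y I.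
  by exists (code p a b s); [exists s | rewrite /= codeK].
Qed.
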